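(* Let $a=1$ and let $b$ be an integer with $a<b$. Let $s=\frac{a-b}{a+b}$ and let $\gamma_{a,b}^s(t)=(1-s)\exp(2\pi i a t)+(1+s)\exp(2\pi i b t)$. Then the curve $\gamma_{a,b}^s$ has a cusp point at every parameter $t=\frac{h}{2(b-a)}$ with $h$ an odd integer, $0\leq h\leq 2(b-a)$.
   Context: The curve is regarded as a smooth one-periodic parametrised curve in $\mathbb{C}\cong\mathbb{R}^2$, defined by the same formula for all $t\in\mathbb{R}$. A parameter $t$ is a singular point of a curve $\gamma$ if $\gamma'(t)=0$. A curve $\gamma$ has a cusp point at $t_0$ if $t_0$ is a singular point, and the one-sided limits of the unit tangent vector, $\lim_{t\to t_0^+}\gamma'(t)/\|\gamma'(t)\|$ and $\lim_{t\to t_0^-}\gamma'(t)/\|\gamma'(t)\|$, exist and are opposite (one is the negative of the other). *)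

(* Defs.v *)
From Stdlib Require Import Reals ZArith Lra Lia.
From Coquelicot Require Export Coquelicot.
Open Scope R_scope.

Definition Cexp (z : C) : C := (exp (Re z) * cos (Im z), exp (Re z) * sin (Im z)).

Record closed_curve := {
  path :> R -> C;
  path_smooth : forall (n : nat) (t : R),
    ex_derive_n (fun u => Re (path u)) n t /\ ex_derive_n (fun u => Im (path u)) n t;
  path_periodic : forall t : R, path (t + 1) = path t
}.

Definition velocity (g : closed_curve) (t : R) : C :=
  (Derive (fun u => Re (g u)) t, Derive (fun u => Im (g u)) t).

Definition singular_point (g : closed_curve) (t : R) : Prop :=
  velocity g t = 0%C.

Definition unit_tangent (g : closed_curve) (t : R) : C :=
  (velocity g t / Cmod (velocity g t))%C.

(* Division is total and a zero velocity gives a zero "unit tangent", so a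
   one-sided limit also requires the velocity not to vanish on that side of [t0];
   otherwise constant curves would have cusps, with both limits 0. *)
Definition tangent_limit (g : closed_curve) (side : (R -> Prop) -> Prop) (l : C) : Prop :=
  side (fun t => ~ singular_point g t) /\ filterlim (unit_tangent g) side (locally l).

Definition cusp_point (g : closed_curve) (t0 : R) : Prop :=
  singular_point g t0 /\
  exists lp lm : C,
    tangent_limit g (at_right t0) lp /\ tangent_limit g (at_left t0) lm /\
    lp = (- lm)%C.

Definition gamma_fun (a b : Z) (s t : R) : C :=
  ((1 - s) * Cexp (2 * PI * Ci * IZR a * t) + (1 + s) * Cexp (2 * PI * Ci * IZR b * t))%C.

Lemma Cexp_imaginary (k t : R) :
  Cexp (2 * PI * Ci * k * t)%C = (cos (2 * PI * k * t), sin (2 * PI * k * t)).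
Proof.
unfold Cexp; cbn.
match goal with |- (exp ?x * cos ?y, _) = _ =>
  replace x with 0 by ring; replace y with (2 * PI * k * t) by ring end.
now rewrite exp_0, !Rmult_1_l.
Qed.

Lemma trig_smooth (w v : R) (n : nat) : forall (p q r u : R) (f : R -> R),
  (forall x, f x = p * cos (w * x) + q * sin (w * x) + r * cos (v * x) + u * sin (v * x)) ->
  forall t, ex_derive_n f n t.
Proof.
intros p q r u f Hf.
assert (H : exists p' q' r' u', forall x, Derive_n f (pred n) x =
  p' * cos (w * x) + q' * sin (w * x) + r' * cos (v * x) + u' * sin (v * x)).
{ induction (pred n) as [|m IH].
  - now exists p, q, r, u.
  - destruct IH as (p' & q' & r' & u' & E).
    exists (w * q'), (- w * p'), (v * u'), (- v * r'); intros x; simpl.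
    rewrite (Derive_ext _ _ x E).
    apply is_derive_unique; auto_derive; [easy | ring]. }
destruct H as (p' & q' & r' & u' & E).
intros t; destruct n as [|m]; [exact I|]; simpl in *.
apply ex_derive_ext with (1 := fun x => eq_sym (E x)).
auto_derive; easy.
Qed.

Lemma gamma_smooth (a b : Z) (s : R) (n : nat) (t : R) :
  ex_derive_n (fun u => Re (gamma_fun a b s u)) n t /\
  ex_derive_n (fun u => Im (gamma_fun a b s u)) n t.
Proof.
split.
- apply (trig_smooth (2 * PI * IZR a) (2 * PI * IZR b) n (1 - s) 0 (1 + s) 0).
  intros x; unfold gamma_fun; rewrite !Cexp_imaginary; cbn; ring.
- apply (trig_smooth (2 * PI * IZR a) (2 * PI * IZR b) n 0 (1 - s) 0 (1 + s)).
  intros x; unfold gamma_fun; rewrite !Cexp_imaginary; cbn; ring.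
Qed.

Lemma trig_period_Z (k : Z) (x : R) :
  cos (x + 2 * IZR k * PI) = cos x /\ sin (x + 2 * IZR k * PI) = sin x.
Proof.
destruct (Z.le_ge_cases 0 k) as [Hk|Hk].
- rewrite <- (Z2Nat.id k Hk), <- INR_IZR_INZ.
  now rewrite cos_period, sin_period.
- set (y := x + 2 * IZR k * PI).
  replace x with (y + 2 * INR (Z.to_nat (- k)) * PI).
  + now rewrite cos_period, sin_period.
  + rewrite INR_IZR_INZ, Z2Nat.id, opp_IZR by lia; unfold y; ring.
Qed.

Lemma gamma_periodic (a b : Z) (s t : R) : gamma_fun a b s (t + 1) = gamma_fun a b s t.
Proof.
assert (H : forall k : Z, Cexp (2 * PI * Ci * IZR k * RtoC (t + 1))%C =
                          Cexp (2 * PI * Ci * IZR k * RtoC t)%C).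
{ intros k; rewrite !Cexp_imaginary.
  replace (2 * PI * IZR k * (t + 1)) with (2 * PI * IZR k * t + 2 * IZR k * PI) by ring.
  now destruct (trig_period_Z k (2 * PI * IZR k * t)) as [-> ->]. }
unfold gamma_fun; now rewrite !H.
Qed.

Definition gamma (a b : Z) (s : R) : closed_curve :=
  {| path := gamma_fun a b s;
     path_smooth := gamma_smooth a b s;
     path_periodic := gamma_periodic a b s |}.

(* Main.v *)
Require Import Defs.
From Stdlib Require Import Reals ZArith.
From Coquelicot Require Import Coquelicot.
From Stdlib Require Import Lra Lia.
Open Scope R_scope.

(** Since [(1 - s) a = (1 + s) b], the two exponentials in the velocity have the
    same weight, so it equals a positive constant times [cos (PI (b - a) t)]
    times the unit vector [i exp (PI i (a + b) t)].  The cosine has a simple zero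
    at every odd multiple of [1 / (2 (b - a))], so the unit tangent jumps there
    from a vector to its opposite. *)

(** Where [r] is positive, the speed is exactly [r], so the velocity does not vanish and normalising
    it gives back [n]. *)
Lemma tangent_limit_of_polar (g : closed_curve) (side : (R -> Prop) -> Prop)
  (r : R -> R) (n : R -> C) (l : C) (Fs : Filter side) :
  (forall t, velocity g t = (r t * n t)%C) ->
  (forall t, Cmod (n t) = 1) ->
  side (fun t => 0 < r t) ->
  filterlim n side (locally l) ->
  tangent_limit g side l.
Proof.
intros Hv Hn Hr Hl.
assert (Hmod : forall t, 0 < r t -> Cmod (velocity g t) = r t).
{ intros t Ht; rewrite Hv, Cmod_mult, Hn, Cmod_R, Rabs_pos_eq; lra. }
split.
- revert Hr; apply filter_imp; intros t Ht Hs.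
  assert (Hm := Hmod t Ht); rewrite Hs, Cmod_0 in Hm; lra.
- refine (filterlim_ext_loc n _ _ Hl).
  revert Hr; apply filter_imp; intros t Ht.
  unfold unit_tangent; rewrite (Hmod t Ht), Hv.
  field; intros E; apply RtoC_inj in E; lra.
Qed.

(** On the right the unit tangent is [n]. On the left the velocity is also [(- r) * (- n)] with
    [- r] positive, so the unit tangent there is [- n]; continuity of [n] makes the two limits
    opposite. *)
Lemma cusp_of_sign_change (g : closed_curve) (r : R -> R) (n : R -> C) (t0 : R) :
  (forall t, velocity g t = (r t * n t)%C) ->
  (forall t, Cmod (n t) = 1) ->
  continuous n t0 ->
  r t0 = 0 ->
  at_right t0 (fun t => 0 < r t) ->
  at_left t0 (fun t => r t < 0) ->
  cusp_point g t0.
Proof.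
intros Hv Hn Hc H0 Hr Hl; split.
{ unfold singular_point; rewrite Hv, H0; ring. }
exists (n t0), (- n t0)%C; split; [|split].
- apply (tangent_limit_of_polar g (at_right t0) r n); try easy.
  + typeclasses eauto.
  + exact (filterlim_filter_le_1 _ (filter_le_within (F := locally t0) _) Hc).
- apply (tangent_limit_of_polar g (at_left t0) (fun t => - r t) (fun t => - n t)%C).
  + typeclasses eauto.
  + intros t; rewrite Hv, RtoC_opp; ring.
  + intros t; rewrite Cmod_opp; apply Hn.
  + revert Hl; apply filter_imp; intros t; lra.
  + apply (filterlim_filter_le_1 _ (filter_le_within (F := locally t0) _)).
    exact (continuous_opp n t0 Hc).
- ring.
Qed.

Lemma gamma_velocity (a b : Z) (s t : R) :
  velocity (gamma a b s) t =
  (- (2 * PI * ((1 - s) * IZR a * sin (2 * PI * IZR a * t)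
                + (1 + s) * IZR b * sin (2 * PI * IZR b * t))),
   2 * PI * ((1 - s) * IZR a * cos (2 * PI * IZR a * t)
             + (1 + s) * IZR b * cos (2 * PI * IZR b * t))).
Proof.
unfold velocity; f_equal.
- rewrite (Derive_ext _ (fun u => (1 - s) * cos (2 * PI * IZR a * u)
                                  + (1 + s) * cos (2 * PI * IZR b * u))).
  + apply is_derive_unique; auto_derive; [easy | ring].
  + intros u; cbn -[Cexp]; unfold gamma_fun; rewrite !Cexp_imaginary; cbn; ring.
- rewrite (Derive_ext _ (fun u => (1 - s) * sin (2 * PI * IZR a * u)
                                  + (1 + s) * sin (2 * PI * IZR b * u))).
  + apply is_derive_unique; auto_derive; [easy | ring].
  + intros u; cbn -[Cexp]; unfold gamma_fun; rewrite !Cexp_imaginary; cbn; ring.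
Qed.

Lemma cos_odd_half_pi (h : Z) : Z.Odd h -> cos (IZR h * PI / 2) = 0.
Proof.
intros [k ->]; rewrite plus_IZR, mult_IZR.
apply cos_eq_0_1; exists k; field.
Qed.

Lemma sin_sign_change (w t0 : R) : 0 < w ->
  at_right t0 (fun t => 0 < sin (w * (t - t0))) /\
  at_left t0 (fun t => sin (w * (t - t0)) < 0).
Proof.
intros Hw; assert (HP := PI_RGT_0).
assert (Hd : 0 < PI / w) by (apply Rdiv_lt_0_compat; assumption).
assert (Hwd : w * (PI / w) = PI) by (field; lra).
(* Within the radius [PI / w] of [t0], the argument of the sine stays strictly between [- PI] and
   [PI]. *)
split; exists (mkposreal _ Hd); intros t Ht Hlt; apply Rabs_def2 in Ht;
  change (t - t0 < PI / w /\ - (PI / w) < t - t0) in Ht.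
- apply sin_gt_0; nra.
- apply sin_lt_0_var; nra.
Qed.

Theorem theorem3 (a b : Z) (ha : a = 1%Z) (hab : (a < b)%Z)
  (s : R) (hs : s = (IZR a - IZR b) / (IZR a + IZR b))
  (h : Z) (hodd : Z.Odd h) (h0 : (0 <= h)%Z) (hle : (h <= 2 * (b - a))%Z) :
  cusp_point (gamma a b s) (IZR h / (2 * (IZR b - IZR a))).
Proof.
assert (Ha : 0 < IZR a) by (apply IZR_lt; lia).
assert (Hab := IZR_lt _ _ hab).
assert (HP := PI_RGT_0).
set (A := IZR a) in *; set (B := IZR b) in *.
set (t0 := IZR h / (2 * (B - A))).
set (w := PI * (B - A)); set (v := PI * (A + B)).
set (K := 8 * PI * A * B / (A + B)).
assert (Hw : 0 < w) by (apply Rmult_lt_0_compat; lra).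
assert (HK : 0 < K).
{ apply Rdiv_lt_0_compat; [|lra]; assert (0 < A * B) by nra; nra. }
set (S := sin (w * t0)).
assert (Hc0 : cos (w * t0) = 0).
{ replace (w * t0) with (IZR h * PI / 2) by (unfold w, t0; field; lra).
  now apply cos_odd_half_pi. }
assert (HS : S * S = 1).
{ assert (E := sin2_cos2 (w * t0)); rewrite Hc0 in E; unfold Rsqr in E; unfold S; lra. }
(* [cos (w t) = - S sin (w (t - t0))] with [S = 1] or [S = -1]: the sign is put
   in the unit vector. *)
assert (Hcos : forall t, cos (w * t) = - S * sin (w * (t - t0))).
{ intros t; replace (w * t) with (w * t0 + w * (t - t0)) by ring.
  rewrite cos_plus, Hc0; unfold S; ring. }
destruct (sin_sign_change w t0 Hw) as [Hright Hleft].
apply (cusp_of_sign_change _ (fun t => K * sin (w * (t - t0)))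
         (fun t => (S * sin (v * t), - S * cos (v * t)))).
- intros t; rewrite gamma_velocity; fold A B.
  (* The choice of [s] gives [1 - s = 2 * B / (A + B)] and [1 + s = 2 * A / (A + B)], hence the
     common weight. *)
  assert (Es : (1 - s) * A = 2 * A * B / (A + B)) by (rewrite hs; field; lra).
  assert (Es' : (1 + s) * B = 2 * A * B / (A + B)) by (rewrite hs; field; lra).
  rewrite Es, Es'.
  (* Sum-to-product: [v] is the mean of the two frequencies and [w] half their difference. The
     resulting factor 2, the factor [2 * PI] and the common weight multiply to [K]. *)
  replace (2 * PI * A * t) with (v * t - w * t) by (unfold v, w; ring).
  replace (2 * PI * B * t) with (v * t + w * t) by (unfold v, w; ring).
  rewrite sin_minus, sin_plus, cos_minus, cos_plus, Hcos.
  unfold K, Cmult, RtoC; cbn [fst snd]; f_equal; field; lra.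
- intros t; unfold Cmod; cbn [fst snd].
  assert (E := sin2_cos2 (v * t)); unfold Rsqr in E.
  rewrite <- sqrt_1; f_equal.
  transitivity ((S * S) * (sin (v * t) * sin (v * t) + cos (v * t) * cos (v * t)));
    [ring | rewrite HS, E; ring].
- apply (filterlim_filter_le_2 (G := filter_prod (locally (S * sin (v * t0)))
                                                 (locally (- S * cos (v * t0))))).
  + intros P [eps HP']; exists (ball (S * sin (v * t0)) eps) (ball (- S * cos (v * t0)) eps).
    * apply locally_ball.
    * apply locally_ball.
    * intros x y Hx Hy; apply HP'; now split.
  + apply filterlim_pair.
    * apply (ex_derive_continuous (fun t => S * sin (v * t))); auto_derive; easy.
    * apply (ex_derive_continuous (fun t => - S * cos (v * t))); auto_derive; easy.
- replace (w * (t0 - t0)) with 0 by ring; rewrite sin_0; ring.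
- revert Hright; apply filter_imp; intros t; nra.
- revert Hleft; apply filter_imp; intros t; nra.
Qed.
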